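(* Let $p\ge 2$ be a prime, let $f:\mathbb{Z}_p\to\mathbb{Z}_p$ be a function and let $k$ be a positive integer. Then $f$ is a $(p^{-k},p^k)$ locally scaling map if and only if $f$ is topologically conjugate to $S^k$ by an isometry, i.e. there exists a homeomorphism $h:\mathbb{Z}_p\to\mathbb{Z}_p$ with $\|h(x)-h(y)\|_p=\|x-y\|_p$ for all $x,y\in\mathbb{Z}_p$ and $S^k\circ h=h\circ f$.
   Context: $\mathbb{Z}_p$ is the ring of $p$-adic integers with the $p$-adic norm $\|\cdot\|_p$ (normalized so that $\|p\|_p=p^{-1}$) and metric $d(x,y)=\|x-y\|_p$. A map $f:\mathbb{Z}_p\to\mathbb{Z}_p$ is $(p^{-k},p^k)$ locally scaling if for all $x,y\in\mathbb{Z}_p$ with $\|x-y\|_p\le p^{-k}$ one has $\|f(x)-f(y)\|_p=p^k\|x-y\|_p$. The shift map $S:\mathbb{Z}_p\to\mathbb{Z}_p$ is $S\left(\sum_{i=0}^{\infty}a_ip^i\right)=\sum_{i=0}^{\infty}a_{i+1}p^i$, where $a_i\in\{0,\ldots,p-1\}$, and $S^k$ is its $k$-fold composition. *)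

(* Defs.v *)
From HB Require Import structures.
From mathcomp Require Import all_boot all_order all_algebra.
From mathcomp Require Import all_classical all_reals topology.
From mathcomp Require Import interval_inference normedtype sequences Rstruct.
From mathcomp Require Import zify ring lra.

Set Implicit Arguments.
Unset Strict Implicit.
Unset Printing Implicit Defensive.

Import Order.TTheory GRing.Theory Num.Theory.

Local Open Scope classical_set_scope.
Local Open Scope ring_scope.

Local Notation R := Rdefinitions.R.

(** Z_p is the inverse limit of the rings Z/p^n: an element is the compatible
    sequence of its residues mod p^n, each represented by its remainder [%%].
    The definition makes sense, and gives a commutative ring, for every natural
    number p (for p = 0 it is the ring of integers, for p = 1 the null ring), so
    primality is only assumed where it is used. *)
Record padic_int (p : nat) := PadicInt {
  residue :> nat -> int;
  residue_compat : `[< forall n, residue n = (residue n.+1 %% (p ^ n)%N)%Z >]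
}.

HB.instance Definition _ (p : nat) := [isSub for @residue p].
HB.instance Definition _ (p : nat) := gen_eqMixin (padic_int p).
HB.instance Definition _ (p : nat) := gen_choiceMixin (padic_int p).

Section Ring.
Variable p : nat.
Implicit Types (x y z : padic_int p) (u v : nat -> int).

Lemma padic_ext x y : (forall n, x n = y n) -> x = y.
Proof. by move=> xy; apply: val_inj; apply: funext. Qed.

Lemma residueS x n : (x n.+1 %% (p ^ n)%N)%Z = x n.
Proof. by case: x => x /= /asboolP <-. Qed.

Lemma residue_mod x n : (x n %% (p ^ n)%N)%Z = x n.
Proof. by rewrite -residueS modz_mod. Qed.

Lemma modz_expS (m : int) n :
  ((m %% (p ^ n.+1)%N)%Z = m %[mod (p ^ n)%N])%Z.
Proof.
rewrite {2}(divz_eq m (p ^ n.+1)%N) expnSr PoszM.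
by rewrite [(_ * (_ * p%:Z))%R]mulrA mulrAC modzMDl.
Qed.

Definition compatible u := forall n, (u n.+1 = u n %[mod (p ^ n)%N])%Z.

Lemma padic_of_subproof u : compatible u ->
  `[< forall n, (u n %% (p ^ n)%N)%Z
                = ((u n.+1 %% (p ^ n.+1)%N)%Z %% (p ^ n)%N)%Z >].
Proof. by move=> cu; apply/asboolP => n; rewrite modz_expS cu. Qed.

Definition padic_of u (cu : compatible u) : padic_int p :=
  PadicInt (padic_of_subproof cu).

Lemma compatible_residue x : compatible x.
Proof. by move=> n; rewrite residueS residue_mod. Qed.

Lemma compatible_cst (m : int) : compatible (fun=> m).
Proof. by []. Qed.

Lemma compatibleD u v :
  compatible u -> compatible v -> compatible (fun n => u n + v n).
Proof. by move=> cu cv n; rewrite -modzDm cu cv modzDm. Qed.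

Lemma compatibleM u v :
  compatible u -> compatible v -> compatible (fun n => u n * v n).
Proof. by move=> cu cv n; rewrite -modzMm cu cv modzMm. Qed.

Lemma compatibleN u : compatible u -> compatible (fun n => - u n).
Proof. by move=> cu n; rewrite -modzNm cu modzNm. Qed.

Definition padic_add x y :=
  padic_of (compatibleD (compatible_residue x) (compatible_residue y)).
Definition padic_mul x y :=
  padic_of (compatibleM (compatible_residue x) (compatible_residue y)).
Definition padic_opp x := padic_of (compatibleN (compatible_residue x)).

Lemma padic_addA : associative padic_add.
Proof. by move=> x y z; apply: padic_ext => n /=; rewrite modzDmr modzDml addrA. Qed.

Lemma padic_addC : commutative padic_add.
Proof. by move=> x y; apply: padic_ext => n /=; rewrite addrC. Qed.

Lemma padic_add0 : left_id (padic_of (compatible_cst 0)) padic_add.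
Proof. by move=> x; apply: padic_ext => n /=; rewrite modzDml add0r residue_mod. Qed.

Lemma padic_addN : left_inverse (padic_of (compatible_cst 0)) padic_opp padic_add.
Proof. by move=> x; apply: padic_ext => n /=; rewrite modzDml addNr. Qed.

HB.instance Definition _ :=
  GRing.isZmodule.Build (padic_int p) padic_addA padic_addC padic_add0 padic_addN.

Lemma padic_mulA : associative padic_mul.
Proof. by move=> x y z; apply: padic_ext => n /=; rewrite modzMmr modzMml mulrA. Qed.

Lemma padic_mulC : commutative padic_mul.
Proof. by move=> x y; apply: padic_ext => n /=; rewrite mulrC. Qed.

Lemma padic_mul1 : left_id (padic_of (compatible_cst 1)) padic_mul.
Proof. by move=> x; apply: padic_ext => n /=; rewrite modzMml mul1r residue_mod. Qed.

Lemma padic_mulDl : left_distributive padic_mul +%R.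
Proof.
by move=> x y z; apply: padic_ext => n /=; rewrite modzMml modzDml modzDmr mulrDl.
Qed.

HB.instance Definition _ :=
  GRing.Zmodule_isComPzRing.Build (padic_int p) padic_mulA padic_mulC padic_mul1 padic_mulDl.

Lemma residue0 n : (0 : padic_int p) n = 0.
Proof. by rewrite /= mod0z. Qed.

Lemma residueD x y n : (x + y) n = ((x n + y n) %% (p ^ n)%N)%Z.
Proof. by []. Qed.

Lemma residueN x n : (- x) n = (- x n %% (p ^ n)%N)%Z.
Proof. by []. Qed.

Lemma residueM x y n : (x * y) n = ((x n * y n) %% (p ^ n)%N)%Z.
Proof. by []. Qed.

Lemma residue_nat (m n : nat) : (m%:R : padic_int p) n = (m %% (p ^ n)%N)%Z.
Proof.
elim: m => [|m IH]; first by rewrite residue0 mod0z.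
by rewrite -addn1 natrD residueD IH modzDm.
Qed.

End Ring.

Section Norm.
Variable p : nat.
Implicit Types x y z : padic_int p.

Lemma residue_neq0 x : x != 0 -> exists n, x n.+1 != 0.
Proof.
move=> x0; apply: contrapT => h; move/eqP: x0; apply.
apply: padic_ext => n; rewrite residue0 -residueS.
have [->|xn] := eqVneq (x n.+1) 0; first by rewrite mod0z.
by case: h; exists n.
Qed.

(** p^n divides x iff the residue of x mod p^n is 0, so for x != 0 the largest
    power of p dividing x is p^n for the least n such that the residue of x
    mod p^(n+1) is nonzero. The value at x = 0 is a dummy. *)
Definition padic_val x : nat :=
  if pselect (exists n, x n.+1 != 0) is left h then ex_minn h else 0%N.

Definition padic_norm x : R := if x == 0 then 0 else p%:R ^- padic_val x.

Lemma residue_eq0_le x m n : (m <= n)%N -> x n = 0 -> x m = 0.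
Proof.
move=> /subnKC <-; elim: (n - m)%N => [|d IH]; first by rewrite addn0.
by rewrite addnS => h; apply: IH; rewrite -residueS h mod0z.
Qed.

Lemma residue_eq0 x n : x != 0 -> (x n == 0) = (n <= padic_val x)%N.
Proof.
move=> x0; rewrite /padic_val; case: pselect => [h|/(_ (residue_neq0 x0))//].
case: ex_minnP => v xv vmin; apply/eqP/idP => [xn|nv].
  rewrite leqNgt; apply/negP => vn.
  by move/eqP: xv; apply; exact: residue_eq0_le vn xn.
case: n nv => [|n nv]; first by rewrite -residueS modz1.
by apply/eqP/negPn/negP => /vmin; rewrite leqNgt nv.
Qed.

Lemma padic_norm0 : padic_norm 0 = 0.
Proof. by rewrite /padic_norm eqxx. Qed.

Lemma padic_val_p0 x : p = 0%N -> padic_val x = 0%N.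
Proof.
move=> p0; have [->|x0] := eqVneq x 0.
  rewrite /padic_val; case: pselect => // h; exfalso.
  by case: h => n; rewrite residue0 eqxx.
apply/eqP; rewrite -leqn0 leqNgt; apply/negP; rewrite -residue_eq0// => /eqP x1.
have h n : x n.+1 = 0.
  elim: n => // n IH; have := residueS x n.+1.
  have -> : (p ^ n.+1)%N = 0%N by rewrite p0 exp0n.
  by rewrite modz0 IH.
by have [n] := residue_neq0 x0; rewrite h eqxx.
Qed.

Lemma padic_norm_ge0 x : 0 <= padic_norm x.
Proof. by rewrite /padic_norm; case: ifP => // _; rewrite invr_ge0 exprn_ge0. Qed.

Lemma padic_norm_eq0 x : padic_norm x = 0 -> x = 0.
Proof.
rewrite /padic_norm; case: eqVneq => // x0 /eqP; rewrite invr_eq0.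
have [p0|p0] := eqVneq p 0%N; first by rewrite padic_val_p0// expr0 oner_eq0.
by rewrite expf_eq0 pnatr_eq0 (negbTE p0) andbF.
Qed.

Lemma padic_valN x : padic_val (- x) = padic_val x.
Proof.
have [->|x0] := eqVneq x 0; first by rewrite oppr0.
have nx0 : - x != 0 by rewrite oppr_eq0.
have e n : (- x) n == 0 = (x n == 0).
  apply/eqP/eqP => h; last by rewrite residueN h mod0z.
  by rewrite -[x]opprK residueN h mod0z.
apply/eqP; rewrite eqn_leq -(residue_eq0 _ x0) -(residue_eq0 _ nx0).
by apply/andP; split; [rewrite -e|rewrite e]; rewrite residue_eq0.
Qed.

Lemma padic_normN x : padic_norm (- x) = padic_norm x.
Proof. by rewrite /padic_norm oppr_eq0 padic_valN. Qed.

Lemma padic_norm_ultra x y : padic_norm (x + y) <= Num.max (padic_norm x) (padic_norm y).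
Proof.
have [->|x0] := eqVneq x 0; first by rewrite add0r le_max lexx orbT.
have [->|y0] := eqVneq y 0; first by rewrite addr0 le_max lexx.
have [->|xy0] := eqVneq (x + y) 0.
  by rewrite padic_norm0 le_max padic_norm_ge0.
rewrite /padic_norm (negbTE x0) (negbTE y0) (negbTE xy0).
have [p0|p0] := eqVneq p 0%N; first by rewrite !padic_val_p0// maxxx.
have mono m n : (m <= n)%N -> (p%:R : R) ^- n <= p%:R ^- m.
  move=> mn; rewrite lef_pV2 ?posrE ?exprn_gt0 ?ltr0n ?lt0n//.
  by rewrite ler_weXn2l// ler1n lt0n.
suff /orP[h|h] : (padic_val x <= padic_val (x + y)%R)%N || (padic_val y <= padic_val (x + y)%R)%N.
- by rewrite le_max mono.
- by rewrite le_max (mono _ _ h) orbT.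
rewrite -!residue_eq0// !residueD.
have [h|h] := leqP (padic_val x) (padic_val y).
  have /eqP-> : x (padic_val x) == 0 by rewrite residue_eq0.
  have /eqP-> : y (padic_val x) == 0 by rewrite residue_eq0.
  by rewrite addr0 mod0z eqxx.
have /eqP-> : x (padic_val y) == 0 by rewrite residue_eq0// ltnW.
have /eqP-> : y (padic_val y) == 0 by rewrite residue_eq0.
by rewrite addr0 mod0z eqxx orbT.
Qed.

Definition padic_dist x y : R := padic_norm (x - y).

Lemma padic_distxx x : padic_dist x x = 0.
Proof. by rewrite /padic_dist subrr padic_norm0. Qed.

Lemma padic_dist_eq0 x y : padic_dist x y = 0 -> x = y.
Proof. by move/padic_norm_eq0/eqP; rewrite subr_eq0 => /eqP. Qed.

Lemma padic_dist_sym x y : padic_dist x y = padic_dist y x.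
Proof. by rewrite /padic_dist -padic_normN opprB. Qed.

Lemma padic_dist_triangle y x z : padic_dist x z <= padic_dist x y + padic_dist y z.
Proof.
rewrite /padic_dist -(subrKA y); apply: le_trans (padic_norm_ultra _ _) _.
by rewrite ge_max lerDl lerDr !padic_norm_ge0.
Qed.

HB.instance Definition _ :=
  isMetric.Build R (padic_int p) padic_distxx padic_dist_eq0 padic_dist_sym padic_dist_triangle.

Lemma padic_norm_p : prime p -> padic_norm p%:R = p%:R^-1.
Proof.
move=> pp; have p1 := prime_gt1 pp.
have r2 : (p%:R : padic_int p) 2%N != 0.
  rewrite residue_nat modz_small ?eqz_nat -?lt0n ?(ltnW p1)//.
  by rewrite lez_nat ltz_nat expnS expn1 ltn_Pmulr// ltnW.
have r1 : (p%:R : padic_int p) 1%N = 0 by rewrite residue_nat expn1 modzz.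
have p0 : (p%:R : padic_int p) != 0.
  by apply/eqP => h; move: r2; rewrite h residue0 eqxx.
rewrite /padic_norm (negbTE p0); suff -> : padic_val p%:R = 1%N by [].
apply/eqP; rewrite eqn_leq -residue_eq0// r1 eqxx andbT.
by rewrite leqNgt -residue_eq0.
Qed.

End Norm.

Section Shift.
Variable p : nat.
Implicit Types (x : padic_int p) (a : nat -> int).

Definition digit_sum a (n : nat) : int := \sum_(i < n) a i * (p ^ i)%N.

Lemma compatible_digit_sum a : compatible p (digit_sum a).
Proof. by move=> n; rewrite /digit_sum big_ord_recr/= addrC modzMDl. Qed.

(** The p-adic number with expansion \sum_i a_i p^i: for digits a_i that are
    natural numbers, it is the limit of this series, see [cvg_of_digits]. *)
Definition of_digits a : padic_int p := padic_of (compatible_digit_sum a).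

(** The i-th digit of x: [digitK] and [digit_range] show that these are the
    coefficients of the expansion of x, [of_digitsK] that it is unique. *)
Definition digit x (i : nat) : int := (x i.+1 %/ (p ^ i)%N)%Z.

Definition padic_shift x : padic_int p := of_digits (fun i => digit x i.+1).

Lemma digit_sum_digit x n : digit_sum (digit x) n = x n.
Proof.
elim: n => [|n IH]; first by rewrite /digit_sum big_ord0 -residueS modz1.
move: IH; rewrite /digit_sum big_ord_recr/= => ->.
by rewrite -{1}(residueS x n) addrC -divz_eq.
Qed.

Lemma digitK x : of_digits (digit x) = x.
Proof. by apply: padic_ext => n /=; rewrite digit_sum_digit residue_mod. Qed.

Hypothesis p_prime : prime p.

Lemma digit_range x i : 0 <= digit x i < p.
Proof.
have p0 := prime_gt0 p_prime; rewrite /digit.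
have pn n : (0 < (p ^ n)%N :> int) by rewrite ltz_nat expn_gt0 p0.
rewrite divz_ge0// -(residue_mod x) modz_ge0 ?gt_eqF//=.
by rewrite ltz_divLR// -PoszM -expnS ltz_pmod.
Qed.

Lemma digit_sum_range a n :
  (forall i, 0 <= a i < p) -> 0 <= digit_sum a n < (p ^ n)%N.
Proof.
move=> ha; elim: n => [|n IH]; first by rewrite /digit_sum big_ord0.
move: IH (ha n); rewrite /digit_sum big_ord_recr/= expnS.
set s := \sum_(_ < _) _; set q := (p ^ n)%N; nia.
Qed.

Lemma of_digitsK a i : (forall i, 0 <= a i < p) -> digit (of_digits a) i = a i.
Proof.
move=> ha; rewrite /digit /= modz_small ?digit_sum_range//.
have := digit_sum_range i ha; rewrite /digit_sum big_ord_recr/= => hi.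
rewrite addrC divzMDl ?divz_small ?addr0//.
by apply/eqP => h; move: hi; rewrite h; lia.
Qed.

Lemma residue_eq0_norm x n : x n = 0 -> padic_norm x <= p%:R ^- n.
Proof.
move=> xn; have p0 := prime_gt0 p_prime.
rewrite /padic_norm; case: eqVneq => [_|x0].
  by rewrite invr_ge0 exprn_ge0.
rewrite lef_pV2 ?posrE ?exprn_gt0 ?ltr0n//.
by rewrite ler_weXn2l ?ler1n// -residue_eq0// xn.
Qed.

Lemma cvg_of_digits (a : nat -> nat) :
  (series (fun i => (a i)%:R * p%:R ^+ i : padic_int p) @ \oo) -->
    of_digits (fun i => a i).
Proof.
have p1 := prime_gt1 p_prime; set l := of_digits _.
have h n : (l - series (fun i => (a i)%:R * p%:R ^+ i : padic_int p) n) n = 0.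
  have -> : series (fun i => (a i)%:R * p%:R ^+ i : padic_int p) n =
      (\sum_(i < n) a i * p ^ i)%N%:R.
    by rewrite /series/= big_mkord natr_sum; apply: eq_bigr => i _;
      rewrite natrM natrX.
  rewrite residueD residueN residue_nat modzNm.
  rewrite modzDmr /= modzDml /digit_sum.
  rewrite [X in (_ - X)%R](_ : _ = \sum_(i < n) (a i)%:Z * (p ^ i)%N%:Z) ?subrr ?mod0z//.
  by rewrite (big_morph Posz PoszD (erefl _)); apply: eq_bigr => i _; rewrite PoszM.
apply/cvg_ballP => e e0; near=> n.
rewrite ballEmdist/=; apply: (le_lt_trans (residue_eq0_norm (h n))).
apply: (@le_lt_trans _ _ (n.+1%:R^-1)); last first.
  by near: n; exact: near_infty_natSinv_lt (PosNum e0).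
have pn0 : 0 < (p%:R : R) ^+ n by rewrite exprn_gt0// ltr0n ltnW.
rewrite lef_pV2 ?posrE//.
by rewrite -natrX ler_nat; exact: ltn_expl.
Unshelve. all: by end_near.
Qed.

Lemma padic_shift_of_digits a : (forall i, 0 <= a i < p) ->
  padic_shift (of_digits a) = of_digits (fun i => a i.+1).
Proof.
by move=> ha; congr of_digits; apply: funext => i; rewrite of_digitsK.
Qed.

End Shift.

Definition locally_scaling (p : nat) (r s : R) (f : padic_int p -> padic_int p) : Prop :=
  forall x y, padic_norm (x - y) <= r -> padic_norm (f x - f y) = s * padic_norm (x - y).

Definition homeomorphism (T U : topologicalType) (h : T -> U) : Prop :=
  continuous h /\ exists g, [/\ cancel h g, cancel g h & continuous g].

(* Main.v *)
(** Both conditions are statements about congruences: f is locally scaling iff,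
    whenever x = y mod p^k, one has f x = f y mod p^n exactly when
    x = y mod p^(n+k); and S^k has this property. Conversely, if f has it, let the
    j-th block of k digits of h x be the first k digits of f^j x (the itinerary
    of x). Then S^k h = h f, and h preserves congruence modulo every p^n, by
    induction on n in steps of k. Such an isometry is injective, hence
    bijective, on the finite rings Z/p^n, hence onto by completeness. *)
Require Import Defs.
From mathcomp Require Import all_boot all_order all_algebra.
From mathcomp Require Import all_classical all_reals topology Rstruct.
From mathcomp Require Import zify.

Import Order.TTheory GRing.Theory Num.Theory.
Local Open Scope ring_scope.

Section Congruences.
Context {p : nat}.
Hypothesis p_prime : prime p.
Implicit Types x y : padic_int p.

Lemma expz_gt0 n : (0 < (p ^ n)%N :> int).
Proof. by rewrite ltz_nat expn_gt0 prime_gt0. Qed.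

Lemma residue_range x n : 0 <= x n < (p ^ n)%N.
Proof. by rewrite -(residue_mod x) modz_ge0 ?ltz_pmod ?gt_eqF ?expz_gt0. Qed.

Lemma residue_eq_le x y m n : (m <= n)%N -> x n = y n -> x m = y m.
Proof.
move=> /subnKC <-; elim: (n - m)%N => [|d IH]; first by rewrite addn0.
by rewrite addnS => h; apply: IH; rewrite -!(residueS _ (m + d)) h.
Qed.

Lemma residue_sub_eq0 x y n : (x - y) n = 0 <-> x n = y n.
Proof.
rewrite residueD residueN modzDmr.
split=> [/dvdz_mod0P|->]; last by rewrite subrr mod0z.
by rewrite -eqz_mod_dvd !modz_small ?residue_range// => /eqP.
Qed.

Lemma padic_norm_le x n : padic_norm x <= p%:R ^- n <-> x n = 0.
Proof.
split; last exact: residue_eq0_norm.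
have p1 := prime_gt1 p_prime.
have [->|x0] := eqVneq x 0; first by rewrite residue0.
rewrite /padic_norm (negbTE x0) lef_pV2 ?posrE ?exprn_gt0 ?ltr0n ?prime_gt0//.
by rewrite ler_eXn2l ?ltr1n// -residue_eq0// => /eqP.
Qed.

(** Norms take only the values 0 and [p^-n], so each is determined by the thresholds [p^-n] that
    bound it. *)
Lemma padic_norm_scale x y k :
  padic_norm x = p%:R ^+ k * padic_norm y <->
  forall n, x n = 0 <-> y (n + k)%N = 0.
Proof.
have pk n : 0 < p%:R ^+ n :> Rdefinitions.R by rewrite exprn_gt0 ?ltr0n ?prime_gt0.
split=> [xy n|xy].
  rewrite -!padic_norm_le xy -[padic_norm y <= _](ler_pM2l (pk k)) exprD.
  by rewrite invfM mulrCA mulfV ?mulr1// gt_eqF.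
have [y0|y0] := eqVneq y 0.
  suff -> : x = 0 by rewrite y0 !padic_norm0 mulr0.
  by apply: padic_ext => n; rewrite residue0; apply/xy; rewrite y0 residue0.
have x0 : x != 0.
  apply/eqP => x0; move/eqP: y0; apply; apply: padic_ext => n.
  rewrite residue0; apply: (residue_eq0_le (leq_addr k n)).
  by apply/xy; rewrite x0 residue0.
have e n : (n <= padic_val x)%N = (n + k <= padic_val y)%N.
  by rewrite -!residue_eq0//; apply/eqP/eqP => /xy.
have -> : padic_norm x = p%:R ^- padic_val x by rewrite /padic_norm (negbTE x0).
have -> : padic_norm y = p%:R ^- (padic_val x + k).
  rewrite /padic_norm (negbTE y0); congr (_ ^- _); apply/eqP.
  (* The instance at 0 gives [k <= padic_val y], so the subtraction below is not truncated; the next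
     two instances give the two inequalities. *)
  have /esym ky := e 0%N; rewrite leq0n in ky.
  have := e (padic_val x); have := e (padic_val y - k)%N.
  by rewrite subnK// !leqnn; lia.
by rewrite exprD invfM mulrCA mulfV ?mulr1// gt_eqF.
Qed.

Lemma locally_scalingP (f : padic_int p -> padic_int p) k :
  locally_scaling (p%:R ^- k) (p%:R ^+ k) f <->
  forall x y, x k = y k -> forall n, f x n = f y n <-> x (n + k)%N = y (n + k)%N.
Proof.
split=> fP x y.
  move=> /residue_sub_eq0/padic_norm_le/fP/padic_norm_scale e n.
  by rewrite -!residue_sub_eq0.
move=> /padic_norm_le/residue_sub_eq0 xy; apply/padic_norm_scale => n.
by rewrite !residue_sub_eq0; exact: fP.
Qed.

Lemma isometryP (h : padic_int p -> padic_int p) :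
  (forall x y, padic_norm (h x - h y) = padic_norm (x - y)) <->
  forall x y n, h x n = h y n <-> x n = y n.
Proof.
have e x y : padic_norm (h x - h y) = padic_norm (x - y) <->
    forall n, h x n = h y n <-> x n = y n.
  (* The factor [p ^+ 0] makes this the case [k = 0] of the scaling criterion. *)
  rewrite -[padic_norm (x - y)]mul1r -(expr0 p%:R) padic_norm_scale.
  by split=> hP n; move: (hP n); rewrite addn0 !residue_sub_eq0.
by split=> hP x y; apply/e/hP.
Qed.

Lemma digit_sum_addn (a : nat -> int) k n :
  digit_sum p a (k + n) =
  digit_sum p a k + (p ^ k)%N%:Z * digit_sum p (fun i => a (i + k)%N) n.
Proof.
rewrite /digit_sum big_split_ord mulr_sumr; congr (_ + _).
apply: eq_bigr => i _ /=.
by rewrite addnC expnD PoszM mulrA mulrC.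
Qed.

Lemma iter_shift_of_digits k (a : nat -> int) : (forall i, 0 <= a i < p) ->
  iter k (@padic_shift p) (of_digits p a) = of_digits p (fun i => a (i + k)%N).
Proof.
move=> ha; elim: k => [|k IH] /=.
  by congr of_digits; apply/funext => i; rewrite addn0.
rewrite IH padic_shift_of_digits//; congr of_digits.
by apply/funext => i; rewrite addSnnS.
Qed.

(** The expansion is cut after [k] digits. Integers are equal here, not merely congruent, because
    sums of digits in range are already reduced. *)
Lemma residue_iter_shift k x n :
  x (n + k)%N = x k + (p ^ k)%N%:Z * iter k (@padic_shift p) x n.
Proof.
rewrite -{3}(digitK x) iter_shift_of_digits; last exact: digit_range.
rewrite /= modz_small; last by apply: digit_sum_range => // i; exact: digit_range.
by rewrite -(digit_sum_digit x k) -digit_sum_addn addnC digit_sum_digit.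
Qed.

(** This is the scaling property of [S^k]: the common first [k] digits cancel, and so does the
    nonzero factor [p^k]. *)
Lemma iter_shift_residue_eq k x y : x k = y k ->
  forall n, iter k (@padic_shift p) x n = iter k (@padic_shift p) y n <->
            x (n + k)%N = y (n + k)%N.
Proof.
move=> xy n; rewrite !(residue_iter_shift k _ n) xy; split=> [->//|].
by move=> /addrI/mulfI; apply; rewrite gt_eqF ?expz_gt0.
Qed.

End Congruences.

Section Isometries.
Context {p : nat}.
Hypothesis p_prime : prime p.
Implicit Types (x y : padic_int p) (h : padic_int p -> padic_int p).

Lemma isometry_residue_surj h : (forall x y n, h x n = h y n <-> x n = y n) ->
  forall y n, exists x, h x n = y n.
Proof.
move=> hP y n.
have absP x : (`|x n| < p ^ n)%N by have := residue_range p_prime x n; lia.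
(* [F] is the map induced by [h] on residues mod [p^n]; absolute values only cast nonnegative
   residues to naturals. *)
pose F (m : 'I_(p ^ n)) := Ordinal (absP (h (m : nat)%:R)).
have absz_inj x x' : `|x n|%N = `|x' n|%N -> x n = x' n.
  have := residue_range p_prime x n; have := residue_range p_prime x' n; lia.
have F_inj : injective F.
  move=> i j /(congr1 val)/= /absz_inj/hP.
  rewrite !residue_nat !modz_nat !modn_small// => -[] ij.
  exact: val_inj.
have [G _ FG] := injF_bij F_inj.
exists (G (Ordinal (absP y)) : nat)%:R; apply: absz_inj.
exact: (congr1 val (FG (Ordinal (absP y)))).
Qed.

Lemma isometry_surj h : (forall x y n, h x n = h y n <-> x n = y n) ->
  forall y, exists x, h x = y.
Proof.
move=> hP y; have [u hu] := choice (isometry_residue_surj h hP y).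
(* [u n] is a preimage of [y] mod [p^n] only; since [h] reflects congruences, these preimages are
   coherent and define a limit. *)
have cu : compatible p (fun n => u n n).
  move=> n; rewrite residueS residue_mod; apply/hP; rewrite hu.
  exact: (residue_eq_le _ _ _ _ (leqnSn n) (hu n.+1)).
exists (padic_of cu); apply: padic_ext => n; rewrite -hu.
by apply/hP; rewrite /= residue_mod.
Qed.

Lemma isometry_continuous h :
  (forall x y, padic_norm (h x - h y) = padic_norm (x - y)) -> continuous h.
Proof.
move=> hP x P /nbhs_ballP[e e0 eP]; apply/nbhs_ballP; exists e => // y xy.
by apply: eP; move: xy; rewrite !ballEmdist/= /mdist/= /padic_dist hP.
Qed.

Lemma isometry_homeomorphism h :
  (forall x y, padic_norm (h x - h y) = padic_norm (x - y)) -> homeomorphism h.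
Proof.
move=> hP; split; first exact: isometry_continuous.
have /(isometryP p_prime) hR := hP.
have [g gK] := choice (isometry_surj h hR).
(* The inverse is again an isometry, hence continuous. *)
exists g; split=> //; last by apply: isometry_continuous => x y; rewrite -hP !gK.
by move=> x; apply: padic_ext => n; apply/hR; rewrite gK.
Qed.

End Isometries.

Section Itinerary.
Context {p : nat}.
Hypothesis p_prime : prime p.
Variables (f : padic_int p -> padic_int p) (k : nat).
Hypothesis k_gt0 : (0 < k)%N.
Implicit Types x y : padic_int p.

Definition itinerary x : padic_int p :=
  of_digits p (fun i => digit (iter (i %/ k) f x) (i %% k)).

(** Dropping [k] digits drops exactly block 0, and block [j + 1] for [x] is block [j] for [f x]. *)
Lemma iter_shift_itinerary x :
  iter k (@padic_shift p) (itinerary x) = itinerary (f x).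
Proof.
rewrite iter_shift_of_digits//; last by move=> i; exact: digit_range.
congr of_digits; apply/funext => i.
by rewrite modnDr divnDr// divnn k_gt0 addn1 iterSr.
Qed.

Lemma itinerary_residue x n : (n <= k)%N -> itinerary x n = x n.
Proof.
move=> nk; rewrite -[RHS]residue_mod -(digit_sum_digit x n) /=.
congr (_ %% _)%Z; apply: eq_bigr => i _.
have ik : (i < k)%N by exact: leq_trans nk.
by rewrite divn_small// modn_small.
Qed.

Hypothesis f_scaling : locally_scaling (p%:R ^- k) (p%:R ^+ k) f.

Lemma itinerary_isometry x y n : itinerary x n = itinerary y n <-> x n = y n.
Proof.
elim/ltn_ind: n x y => n IH x y.
have [nk|/ltnW kn] := leqP n k; first by rewrite !itinerary_residue.
have hk z : itinerary z k = z k by exact: itinerary_residue.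
(* If [x] and [y] differ mod [p^k], so do their itineraries, and both sides fail since [k <= n]. *)
have [xy|xy] := eqVneq (x k) (y k); last first.
  split=> /(residue_eq_le _ _ _ _ kn) e; case/eqP: xy => //.
  by rewrite -(hk x) -(hk y).
have hxy : itinerary x k = itinerary y k by rewrite !hk.
(* Shifting passes to level [n - k < n] for [f x] and [f y], where induction applies; scaling of [f]
   then returns to level [n] for [x] and [y]. *)
rewrite -(subnK kn) -(iter_shift_residue_eq p_prime _ _ _ hxy).
rewrite !iter_shift_itinerary IH; last by lia.
by move/(locally_scalingP p_prime): f_scaling; exact.
Qed.

End Itinerary.

Theorem proposition11 (p : nat) (p_prime : prime p)
    (f : padic_int p -> padic_int p) (k : nat) (k_gt0 : (0 < k)%N) :
  locally_scaling (p%:R ^- k) (p%:R ^+ k) f <->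
  exists h : padic_int p -> padic_int p,
    [/\ homeomorphism h,
        forall x y, padic_norm (h x - h y) = padic_norm (x - y) &
        iter k (@padic_shift p) \o h =1 h \o f].
Proof.
split=> [f_scaling|[h [_ /(isometryP p_prime) hP hf]]].
  have hP : forall x y,
      padic_norm (itinerary f k x - itinerary f k y) = padic_norm (x - y).
    by apply/(isometryP p_prime)/itinerary_isometry.
  exists (itinerary f k); split=> //; first exact: isometry_homeomorphism.
  by move=> x; exact: iter_shift_itinerary.
apply/(locally_scalingP p_prime) => x y xy n.
have fh z : h (f z) = iter k (@padic_shift p) (h z) by rewrite -[LHS]hf.
(* [h] carries the congruences to [h x] and [h y], where the scaling of [S^k] applies, and back. *)
by rewrite -hP !fh (iter_shift_residue_eq p_prime) ?hP.
Qed.
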